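(* There exist four conditionally convergent series of real numbers $\sum_{n\in\mathbb{N}} a^1_n$, $\sum_{n\in\mathbb{N}} a^2_n$, $\sum_{n\in\mathbb{N}} a^3_n$, $\sum_{n\in\mathbb{N}} a^4_n$ such that no single set $A\subseteq\mathbb{N}$ sends all four series to infinity; that is, for every $A\subseteq\mathbb{N}$ there is some $i\in\{1,2,3,4\}$ such that the subseries $\sum_{n\in A}a^i_n$ sums neither to $\infty$ nor to $-\infty$.
   Context: A series $\sum_{n\in\mathbb{N}}a_n$ of real numbers is conditionally convergent if it converges (to a real number) but $\sum_{n\in\mathbb{N}}|a_n|$ does not converge. For $A\subseteq\mathbb{N}$, $\sum_{n\in A}a_n$ denotes the subseries consisting only of those terms with index in $A$, taken in increasing order of the index. A set $A\subseteq\mathbb{N}$ sends $\sum_{n\in\mathbb{N}}a_n$ to infinity if the partial sums of $\sum_{n\in A}a_n$ tend to $\infty$ or tend to $-\infty$. *)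

(* Defs.v *)
From HB Require Import structures.
From mathcomp Require Import all_boot all_order all_algebra.
From mathcomp Require Import all_classical all_reals all_analysis.
Set Implicit Arguments.
Unset Strict Implicit.
Unset Printing Implicit Defensive.
Import Order.TTheory GRing.Theory Num.Theory.
Import numFieldNormedType.Exports.
Local Open Scope classical_set_scope.
Local Open Scope ring_scope.

Definition conditionally_convergent (R : realType) (a : nat -> R) : Prop :=
  cvgn (series a) /\ ~ cvgn (series (fun n => `|a n|)).

(* The subseries with index set A is the series of [a \o e], where e is the
   increasing enumeration of A. Such an e exists (and is unique) exactly when
   A is infinite; for finite A the subseries is a finite sum, and A does not
   send the series to infinity. *)
Definition sends_to_infinity (R : realType) (A : set nat) (a : nat -> R) :
    Prop :=
  exists e : nat -> nat, [/\ increasing_seq e, range e = A &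
    (series (a \o e) @ \oo --> +oo) \/ (series (a \o e) @ \oo --> -oo)].

(* Main.v *)
Require Import Defs.
From mathcomp Require Import all_boot all_order all_algebra.
From mathcomp Require Import all_classical all_reals all_analysis.
From mathcomp Require Import zify ring lra.
Import Order.TTheory GRing.Theory Num.Theory.
Import numFieldNormedType.Exports.
Local Open Scope classical_set_scope.
Local Open Scope ring_scope.

(** Every term of the four series comes next to its negative, and the pairs
    are grouped in successive stages of rapidly growing length.  The pair of
    index [m] contributes [v, - v] at the indices [2 m] and [2 m + 1], where
    the vector [v] of R^4 depends only on the stage [k] of [m]: it is
    [(b, b, d, 0)] for even [k] and [(b, - b, 0, d)] for odd [k], with
    [b = 2^-k] and [d] the inverse of the end of the stage.  Since [v] tends
    to 0, all four series converge to 0; the number of pairs in a stage makes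
    each series of absolute values diverge.

    Suppose that [A] sends all four subseries to infinity.  During stage [k]
    the partial sums over [A] move by [J v] for a single number [J], the net
    number of selected terms.  The third subseries moves only in the even
    stages, by [J d].  It is unbounded, so infinitely often [|J d| > 2^-k]
    ([exists_dominant_stage]).  Stages are so long that the common
    displacement [J b] of the first two partial sums then exceeds everything
    accumulated before, and both end the stage with the same sign
    ([dominant_stage_sign]).  Likewise the fourth subseries forces infinitely
    many odd stages at whose end the first two partial sums have opposite
    signs.  Both cannot happen when these two partial sums have eventually
    constant signs. *)

(** * Stages *)

(** Doubly exponential growth makes the length of a stage comparable to the
    square of the number of all earlier pairs, and this number itself beats the
    factors [4 ^ k] lost to the size of the terms. *)
Definition stage_start (k : nat) : nat := (2 ^ (2 ^ k))%N.

(** The numbers below [stage_start 1], including those below [stage_start 0],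
    are all put in stage 0. *)
Definition stage (m : nat) : nat := trunc_log 2 (trunc_log 2 m).

Lemma stage_eq k m :
  (stage_start k <= m < stage_start k.+1)%N -> stage m = k.
Proof.
move=> /andP[km mk]; apply: trunc_log_eq => //.
have m0 : (0 < m)%N by apply: leq_trans km; rewrite expn_gt0.
rewrite trunc_log_max //= -(ltn_exp2l _ _ (isT : 1 < 2)%N).
by rewrite (leq_ltn_trans _ mk) // trunc_logP.
Qed.

Lemma leq_stage k m : (stage_start k <= m)%N -> (k <= stage m)%N.
Proof. by move=> km; rewrite trunc_log_max// trunc_log_max. Qed.

Lemma stage_startS k :
  stage_start k.+1 = (stage_start k * stage_start k)%N.
Proof. by rewrite /stage_start expnS mul2n -addnn expnD. Qed.

Lemma exp4_leq_stage_start k : (2 ^ k * 2 ^ k <= stage_start k)%N.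
Proof.
rewrite -expnD leq_exp2l //; elim: k => [//|k IHk].
case: k IHk => [//|k] IHk; rewrite expnS.
by apply: (@leq_trans (2 * (k.+1 + k.+1))%N); [lia|rewrite leq_mul2l IHk].
Qed.

Lemma leq_stage_start k : (k <= stage_start k)%N.
Proof.
rewrite (leq_trans (ltnW (ltn_expl k (isT : 1 < 2)%N)))//.
by rewrite leq_exp2l// ltnW// ltn_expl.
Qed.

Lemma stage_startS_ge2 k : (2 * stage_start k <= stage_start k.+1)%N.
Proof.
rewrite stage_startS leq_mul2r -[X in _ || (X <= _)%N](expn1 2).
by rewrite leq_exp2l// expn_gt0 orbT.
Qed.

(** * Alternating pairs *)

Definition paired {R : realType} (v : nat -> R) (n : nat) : R :=
  (-1) ^+ n * v n./2.

Lemma series_paired (R : realType) (v : nat -> R) n :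
  series (paired v) n = if odd n then v n./2 else 0.
Proof.
elim: n => [|n IHn]; first by rewrite seriesEnat /= big_geq.
rewrite seriesEnat /= big_nat_recr //=.
rewrite [X in X + _](_ : _ = series (paired v) n); last by rewrite seriesEnat.
rewrite IHn /paired -signr_odd uphalf_half; case: (odd n) => /=.
  by rewrite expr1; ring.
by rewrite expr0 add0r mul1r.
Qed.

Lemma cvg_series_paired (R : realType) (v : nat -> R) :
  v @ \oo --> 0 -> cvgn (series (paired v)).
Proof.
move=> v0; apply/cvg_ex; exists 0; apply/cvgrPdist_le => e e0.
move/cvgrPdist_le : v0 => /(_ e e0)[N _ vN]; exists N.*2 => //= n Nn.
rewrite series_paired; case: ifP => _; last by rewrite subrr normr0 ltW.
by apply: vN => /=; rewrite -(half_bit_double N false) add0n half_leq.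
Qed.

Lemma series_abs_paired (R : realType) (v : nat -> R) n :
  series (fun m => `|paired v m|) n.*2 = 2 * \sum_(0 <= m < n) `|v m|.
Proof.
rewrite seriesEnat /=; elim: n => [|n IHn]; first by rewrite !big_geq// mulr0.
rewrite doubleS !big_nat_recr //= IHn /paired !normrM !normrX normrN1 !expr1n /=.
by rewrite uphalf_double doubleK; ring.
Qed.

(** A convergent series has small increments between the ends of consecutive
    blocks; here the blocks [p k <= m < p k.+1] are those of the pairs. *)
Lemma series_abs_paired_diverges (R : realType) (v : nat -> R) (p : nat -> nat) :
  (forall k, (k <= p k)%N) -> (forall k, (p k <= p k.+1)%N) ->
  (forall K, exists2 k, (K <= k)%N &
     1 / 2 <= \sum_(p k <= m < p k.+1) `|v m|) ->
  ~ cvgn (series (fun n => `|paired v n|)).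
Proof.
move=> kp pS vp /cvg_ex[/= l /cvgrPdist_lt /(_ (1 / 2))]; case; first by lra.
move=> N _ lN; have [k Nk] := vp N.
have /= := lN (p k).*2; have /= := lN (p k.+1).*2.
rewrite !series_abs_paired (big_cat_nat (n := p k))//=.
set u := \sum_(0 <= _ < _) _; set w := \sum_(_ <= _ < _) _ => l1 l2 w2.
have /l1 : (N <= (p k.+1).*2)%N by have := kp k; have := pS k; lia.
have /l2 : (N <= (p k).*2)%N by have := kp k; lia.
by rewrite !ltr_norml => /andP[? ?] /andP[? ?]; lra.
Qed.

(** * Subseries *)

(** Partial sums of the subseries indexed by the position in the whole series,
    which makes subseries of different series over the same [A] comparable
    without an enumeration of [A]. *)
Definition partial {R : realType} (A : set nat) (a : nat -> R) (n : nat) : R :=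
  \sum_(0 <= m < n | m \in A) a m.

Lemma partialS (R : realType) (A : set nat) (a : nat -> R) n :
  partial A a n.+1 = partial A a n + (if n \in A then a n else 0).
Proof. by rewrite /partial !(big_mkcond (fun m => m \in A)) big_nat_recr. Qed.

(** The number of terms [p] does not depend on [a]: it is the number of
    elements of [A] below [n], expressed through the enumeration [e]. *)
Lemma partial_subseries (R : realType) (A : set nat) (e : nat -> nat) n :
  increasing_seq e -> range e = A ->
  exists p, (forall i, (e i < n)%N = (i < p)%N) /\
    forall a : nat -> R, partial A a n = series (a \o e) p.
Proof.
move=> e_incr eA; elim: n => [|n [p [ep ap]]].
  exists 0%N; split=> [i|a]; first by rewrite !ltn0.
  by rewrite /partial seriesEnat /= !big_geq.
have [nA|nA] := boolP (n \in A); last first.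
  exists p; split=> [i|a]; last first.
    by rewrite -ap partialS (negbTE nA) addr0.
  rewrite ltnS leq_eqVlt ep; case: eqP => [ein|//]; move: nA.
  by rewrite -ein -eA notin_setE => -[]; exists i.
have [i0 _ ei0] : range e n by rewrite eA -in_setE.
have i0p : i0 = p.
  have pi0 : (p <= i0)%N by rewrite leqNgt -ep ei0 ltnn.
  apply/eqP; rewrite eqn_leq pi0 andbT.
  by have := e_incr i0 p; rewrite ei0 !leEnat => <-; rewrite leqNgt ep ltnn.
exists p.+1; split=> [i|a].
  by have := e_incr i p; rewrite -i0p ei0 !leEnat !ltnS.
rewrite partialS nA ap seriesEnat /= big_nat_recr//=.
by rewrite -[in a (e p)]i0p ei0.
Qed.

(** The bit [b] records the sign of the infinite limit. *)
Lemma sends_to_infinity_partial (R : realType) (A : set nat) (a : nat -> R) :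
  sends_to_infinity A a ->
  exists b : bool, forall M : R, exists N : nat, forall n, (N <= n)%N ->
    M < (-1) ^+ b * partial A a n.
Proof.
move=> [e [e_incr eA div]].
have [b bdiv] : exists b : bool, forall M, exists N, forall n, (N <= n)%N ->
    M < (-1) ^+ b * series (a \o e) n.
  case: div => [/cvgryPgt dv|/cvgrNyPlt dv].
    exists false => M; have [N _ NM] := dv M; exists N => n Nn.
    by rewrite expr0 mul1r; exact: NM.
  exists true => M; have [N _ NM] := dv (- M); exists N => n Nn.
  by rewrite expr1 mulN1r ltrNr; exact: NM.
exists b => M; have [N NM] := bdiv M; exists (e N).+1 => n Nn.
have [p [ep ->]] := @partial_subseries R A e n e_incr eA.
by apply: NM; rewrite ltnW// -ep.
Qed.

(** Selecting the indices in [A] keeps the first term of the pair [m], its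
    opposite, both or none: the contribution is the common value times this
    number, which is 1, -1 or 0. *)
Definition net {R : realType} (A : set nat) (m : nat) : R :=
  (m.*2 \in A)%:R - (m.*2.+1 \in A)%:R.

Lemma norm_net (R : realType) (A : set nat) m : `|net A m : R| <= 1.
Proof.
by rewrite /net; do 2 case: (_ \in A);
  rewrite ?subrr ?subr0 ?sub0r ?normrN ?normr0 ?normr1.
Qed.

Lemma partial_paired (R : realType) (A : set nat) (v : nat -> R) n :
  partial A (paired v) n.*2 = \sum_(0 <= m < n) net A m * v m.
Proof.
rewrite /partial big_mkcond /=; elim: n => [|n IHn]; first by rewrite !big_geq.
rewrite doubleS !big_nat_recr //= IHn /paired /= uphalf_double doubleK.
rewrite -(signr_odd _ n.*2.+1) -(signr_odd _ n.*2) /= odd_double /net expr0 expr1.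
by do 2 case: (_ \in A); rewrite /=; ring.
Qed.

(** * The four series *)

(** The [i]-th coordinate of the vector attached to the pairs of stage [k]. *)
Definition coord {R : realType} (i : 'I_4) (k : nat) : R :=
  match val i with
  | 0%N => 2^-1 ^+ k
  | 1%N => (-1) ^+ k * 2^-1 ^+ k
  | 2%N => if odd k then 0 else (stage_start k.+1)%:R^-1
  | _ => if odd k then (stage_start k.+1)%:R^-1 else 0
  end.

Lemma stage_start_gt0 (R : realType) k : 0 < (stage_start k)%:R :> R.
Proof. by rewrite ltr0n expn_gt0. Qed.

Lemma inv_stage_start_le (R : realType) k :
  (stage_start k.+1)%:R^-1 <= 2^-1 ^+ k :> R.
Proof.
rewrite exprVn lef_pV2 ?posrE ?stage_start_gt0 ?exprn_gt0//.
rewrite -natrX ler_nat leq_exp2l// (leq_trans (ltnW (ltn_expl k (isT : 1 < 2)%N)))//.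
by rewrite leq_exp2l.
Qed.

Lemma norm_coord_le (R : realType) i k : `|coord i k : R| <= 2^-1 ^+ k.
Proof.
have h0 : 0 <= 2^-1 ^+ k :> R by rewrite exprn_ge0// invr_ge0.
rewrite /coord; case: (val i) => [|[|[|_]]].
- by rewrite ger0_norm.
- by rewrite normrM normrX normrN1 expr1n mul1r ger0_norm.
- by case: (odd k); rewrite ?normr0// ger0_norm ?invr_ge0 ?inv_stage_start_le.
- by case: (odd k); rewrite ?normr0// ger0_norm ?invr_ge0 ?inv_stage_start_le.
Qed.

(** The parity condition avoids the stages in which the coordinate vanishes. *)
Lemma coord_ge (R : realType) (i : 'I_4) k :
  odd k = (val i == 3)%N -> (stage_start k.+1)%:R^-1 <= `|coord i k : R|.
Proof.
have h0 : 0 <= 2^-1 ^+ k :> R by rewrite exprn_ge0// invr_ge0.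
rewrite /coord; case: i => -[|[|[|[|//]]]] /= _ ok.
- by rewrite ger0_norm// inv_stage_start_le.
- by rewrite normrM normrX normrN1 expr1n mul1r ger0_norm// inv_stage_start_le.
- by rewrite ok ger0_norm ?invr_ge0.
- by rewrite ok ger0_norm ?invr_ge0.
Qed.

Lemma coord_stage_cvg0 (R : realType) i :
  (fun m => coord i (stage m) : R) @ \oo --> 0.
Proof.
apply/cvgrPdist_le => e e0.
have : (fun k => 2^-1 ^+ k : R) @ \oo --> 0.
  by apply: cvg_expr; rewrite gtr0_norm ?invr_gt0// invf_lt1// ltr1n.
move=> /cvgrPdist_le /(_ e e0)[K _ Ke]; exists (stage_start K) => //= m Km.
rewrite sub0r normrN (le_trans (norm_coord_le _ _ _))//.
have := Ke _ (leq_stage _ _ Km).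
by rewrite /= sub0r normrN; apply: le_trans; rewrite ler_norm.
Qed.

Definition four_series {R : realType} (i : 'I_4) : nat -> R :=
  paired (fun m => coord i (stage m)).

Lemma sum_stage (R : realType) (f : nat -> nat -> R) k :
  \sum_(stage_start k <= m < stage_start k.+1) f m (stage m) =
  \sum_(stage_start k <= m < stage_start k.+1) f m k.
Proof. by apply: eq_big_nat => m km; rewrite (stage_eq _ _ km). Qed.

(** At least half of the numbers below the end of a stage lie in it, so a stage
    of the right parity contributes at least 1/2 to the sum of the absolute
    values. *)
Lemma four_series_conditionally_convergent (R : realType) i :
  conditionally_convergent (four_series i : nat -> R).
Proof.
split; first exact/cvg_series_paired/coord_stage_cvg0.
apply: (series_abs_paired_diverges _ _ stage_start).
- exact: leq_stage_start.
- by move=> k; have := stage_startS_ge2 k; lia.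
move=> K; pose k := (K.*2 + (val i == 3))%N; exists k; first by rewrite /k; lia.
rewrite (sum_stage _ (fun _ j => `|coord i j|)) sumr_const_nat.
have ok : odd k = (val i == 3)%N by rewrite /k oddD odd_double; case: (_ == _).
have := coord_ge R _ _ ok; set c := `| _ |; set L := stage_start k.+1 => Lc.
have L0 : 0 < L%:R :> R by exact: stage_start_gt0.
apply: (@le_trans _ _ (L%:R^-1 *+ (L - stage_start k))); last by rewrite lerMn2r Lc orbT.
rewrite -[leRHS]mulr_natr [leRHS]mulrC ler_pdivlMr// mulrAC mul1r ler_pdivrMr//.
by rewrite -natrM ler_nat; have := stage_startS_ge2 k; rewrite -/L; lia.
Qed.

(** * Dominant stages *)

(** Otherwise the increments from [K] on would be dominated by a geometric
    series, and [y] would be bounded. *)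
Lemma unbounded_steps (R : realType) (y : nat -> R) K :
  (forall M, exists n, (K <= n)%N /\ M < `|y n|) ->
  exists k, (K <= k)%N /\ 2^-1 ^+ k < `|y k.+1 - y k|.
Proof.
move=> yub; apply: contrapT => small.
have {}small k : (K <= k)%N -> `|y k.+1 - y k| <= 2^-1 ^+ k.
  by move=> Kk; rewrite leNgt; apply/negP => ky; apply: small; exists k.
(* [2 - 2 * 2^-n] is the sum of the first [n] terms of the geometric series *)
have ybd n : `|y (K + n)%N| <= `|y K| + 2 - 2 * 2^-1 ^+ n.
  elim: n => [|n IHn]; first by rewrite addn0 expr0; lra.
  have := small _ (leq_addr n K); rewrite addnS.
  have := ler_normD (y (K + n)%N) (y (K + n).+1 - y (K + n)%N); rewrite addrC subrK.
  have : 2^-1 ^+ (K + n) <= 2^-1 ^+ n :> R.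
    by rewrite ler_wiXn2l// ?leq_addl// invf_le1// ler1n.
  by rewrite exprS; lra.
have [n [Kn]] := yub (`|y K| + 2).
have := ybd (n - K)%N; rewrite subnKC//.
have : 0 <= 2^-1 ^+ (n - K) :> R by rewrite exprn_ge0// invr_ge0.
by lra.
Qed.

(** A shift larger than both [x] and [y] gives them its own sign. *)
Lemma dominant_sign (R : realType) (x y w : R) :
  `|x| < `|w| -> `|y| < `|w| -> 0 < (x + w) * (y + w).
Proof.
move=> /ltr_normlP[xw1 xw2] /ltr_normlP[yw1 yw2].
have [w0|w0] := leP 0 w.
  by rewrite ger0_norm// in xw1 xw2 yw1 yw2; apply: mulr_gt0; lra.
by rewrite ltr0_norm// in xw1 xw2 yw1 yw2; rewrite -mulrNN; apply: mulr_gt0; lra.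
Qed.

(** The factor 2 accounts for the two terms of each pair. *)
Definition position {R : realType} (A : set nat) (i : 'I_4) (k : nat) : R :=
  partial A (four_series i) (stage_start k).*2.

Definition stage_net {R : realType} (A : set nat) (k : nat) : R :=
  \sum_(stage_start k <= m < stage_start k.+1) net A m.

Lemma positionS (R : realType) A i k :
  position A i k.+1 = position A i k + coord i k * stage_net A k :> R.
Proof.
rewrite /position !partial_paired (big_cat_nat (n := stage_start k))//=.
  by rewrite (sum_stage _ (fun m j => net A m * coord i j)) -mulr_suml mulrC.
by have := stage_startS_ge2 k; lia.
Qed.

(** Each pair contributes at most 1, so the past of a stage is bounded by the
    number of earlier pairs. *)
Lemma norm_position (R : realType) A i k :
  `|position A i k : R| <= (stage_start k)%:R.
Proof.
rewrite /position partial_paired (le_trans (ler_norm_sum _ _ _))//.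
rewrite -[stage_start k in leRHS]subn0 -sumr_const_nat.
apply: ler_sum => m _; rewrite normrM mulr_ile1 ?norm_net//.
by rewrite (le_trans (norm_coord_le _ _ _))// exprn_ile1// ?invr_ge0// invf_le1// ler1n.
Qed.

(** The last two series move only in stages of one parity and by tiny amounts,
    so that their divergence forces a nonnegligible share of the terms of some
    late stage to be selected with a net sign.  In the first two series the
    same choice produces a displacement larger than all that precedes. *)
Lemma exists_dominant_stage (R : realType) (A : set nat) (i : 'I_4) K :
  (1 < val i)%N ->
  sends_to_infinity A (four_series i : nat -> R) ->
  exists k, [/\ (K <= k)%N, odd k = (val i == 3)%N &
    (stage_start k)%:R < `|2^-1 ^+ k * stage_net A k : R|].
Proof.
move=> i1 /sends_to_infinity_partial[b bdiv].
have [M|k [Kk]] := @unbounded_steps R (position A i) K.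
  have [N NM] := bdiv M; exists (maxn K N); split; first exact: leq_maxl.
  rewrite (lt_le_trans (NM (stage_start (maxn K N)).*2 _))//.
    by have := leq_stage_start (maxn K N); lia.
  by rewrite (le_trans (ler_norm _))// normrM normrX normrN1 expr1n mul1r.
rewrite positionS addrAC subrr add0r normrM => step.
have h0 : 0 < 2^-1 ^+ k :> R by rewrite exprn_gt0// invr_gt0.
have [ok c] : odd k = (val i == 3)%N /\
    `|coord i k : R| = (stage_start k.+1)%:R^-1.
  have s0 : 0 < (stage_start k.+1)%:R^-1 :> R.
    by rewrite invr_gt0 stage_start_gt0.
  move: step; rewrite /coord.
  by case: i i1 {bdiv} => -[|[|[|[|//]]]] //= _ _; case: (odd k);
    rewrite ?normr0 ?mul0r ?(gtr0_norm s0) // => /(lt_trans h0); rewrite ltxx.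
exists k; split => //.
rewrite normrM (gtr0_norm h0).
move: step; rewrite c mulrC ltr_pdivlMr ?stage_start_gt0// => step.
(* [2^-k * 2^-k * stage_start k ^ 2] is at least [stage_start k], as
   [4 ^ k <= stage_start k]. *)
apply: le_lt_trans (_ : 2^-1 ^+ k * (2^-1 ^+ k * (stage_start k.+1)%:R) < _); last first.
  by rewrite ltr_pM2l.
rewrite mulrA exprVn -invfM mulrC ler_pdivlMr; last first.
  by rewrite mulr_gt0 ?exprn_gt0.
rewrite -natrX -!natrM ler_nat stage_startS leq_mul2l.
by rewrite exp4_leq_stage_start orbT.
Qed.

(** The second partial sum moves by [(-1) ^ k] times the displacement of the
    first one: after a dominant stage their signs agree or differ according to
    the parity of the stage. *)
Lemma dominant_stage_sign (R : realType) (A : set nat) (i0 i1 : 'I_4) k :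
  val i0 = 0%N -> val i1 = 1%N ->
  (stage_start k)%:R < `|2^-1 ^+ k * stage_net A k : R| ->
  0 < (-1) ^+ k * (position A i0 k.+1 * position A i1 k.+1) :> R.
Proof.
move=> e0 e1; rewrite !positionS /coord e0 e1; set w := 2^-1 ^+ k * stage_net A k => kw.
have := norm_position R A i0 k; have := norm_position R A i1 k.
move: (position A i0 k) (position A i1 k) => x y yk xk.
have sk : (-1) ^+ k * (-1) ^+ k = 1 :> R by rewrite -exprMn mulrNN mulr1 expr1n.
rewrite [ltRHS](_ : _ = (x + w) * ((-1) ^+ k * y + w)).
  apply: dominant_sign; first exact: le_lt_trans kw.
  by rewrite normrM normrX normrN1 expr1n mul1r; exact: le_lt_trans kw.
rewrite mulrCA; congr (_ * _); rewrite mulrDr; congr (_ + _).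
by rewrite !mulrA sk mul1r.
Qed.

Theorem mainTheorem2 (R : realType) :
  exists a : 'I_4 -> nat -> R,
    (forall i : 'I_4, conditionally_convergent (a i)) /\
    (forall A : set nat, exists i : 'I_4, ~ sends_to_infinity A (a i)).
Proof.
exists four_series; split; first exact: four_series_conditionally_convergent.
move=> A; apply: contrapT => noi.
have inf i : sends_to_infinity A (four_series i : nat -> R).
  by apply: contrapT => ni; apply: noi; exists i.
pose o (j : nat) (j4 : (j < 4)%N) : 'I_4 := Ordinal j4.
pose i0 := o 0%N isT; pose i1 := o 1%N isT.
have [b0 /(_ 0)[N0 pos0]] := sends_to_infinity_partial _ _ _ (inf i0).
have [b1 /(_ 0)[N1 pos1]] := sends_to_infinity_partial _ _ _ (inf i1).
(* A dominant stage forced by series [i] computes the relative sign of the two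
   limits from its own parity, and the indices 2 and 3 force different parities. *)
have parity (i : 'I_4) : (1 < val i)%N -> (val i == 3)%N = b0 (+) b1.
  move=> i2.
  have [k [Nk <- dom]] := exists_dominant_stage R A i (maxn N0 N1) i2 (inf i).
  have := dominant_stage_sign R A i0 i1 k erefl erefl dom.
  have Sk := leq_stage_start k.+1.
  have := pos0 (stage_start k.+1).*2 ltac:(lia).
  have := pos1 (stage_start k.+1).*2 ltac:(lia).
  rewrite -!/(position _ _ _) => p1 p0.
  move: (mulr_gt0 p0 p1); rewrite mulrACA -signr_addb -(signr_odd _ k).
  set p := _ * position _ _ _; case: (b0 (+) b1); case: (odd k) => //=;
    by rewrite !(expr0, expr1); lra.
by have := parity (o 2%N isT) isT; rewrite -(parity (o 3%N isT) isT).
Qed.
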